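(* Let $\Omega=\{1,2,3\}^{\mathbb N}$ with the shift $\sigma$, and let $A:\Omega\to\mathbb R$ be the potential depending only on the first two coordinates given by $A(x)=-\varepsilon_{x_0x_1}$, where $\varepsilon_{11}=\varepsilon_{22}=0$ and $\varepsilon_{ij}>0$ for every other pair $(i,j)\in\{1,2,3\}^2$. Let $\mathcal P(\beta)$ be the pressure of $\beta A$, let $\rho=-\lim_{\beta\to+\infty}\frac1\beta\log\mathcal P(\beta)$, and let $g(\beta)=\mathcal P(\beta)e^{\rho\beta}$. Then the function $g$ admits a (finite) limit as $\beta\to+\infty$.
   Context: $\sigma(x_0x_1x_2\ldots)=x_1x_2\ldots$. The pressure is $\mathcal P(\beta)=\sup_\mu\{h_\mu+\beta\int A\,d\mu\}$ over $\sigma$-invariant Borel probability measures $\mu$ on $\Omega$, with $h_\mu$ the Kolmogorov(-Sinai) entropy; equivalently $e^{\mathcal P(\beta)}$ is the spectral radius of the $3\times3$ matrix with entries $e^{-\beta\varepsilon_{ij}}$. The limit defining $\rho$ exists and $\rho$ is a positive real number, so $g$ is a positive function with $\frac1\beta\log g(\beta)\to0$ as $\beta\to+\infty$. *)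

(* Defs.v *)
From HB Require Import structures.
From mathcomp Require Import all_boot all_order all_algebra.
From mathcomp Require Import all_classical all_reals all_analysis.

Set Implicit Arguments.
Unset Strict Implicit.
Unset Printing Implicit Defensive.

Import Order.TTheory GRing.Theory Num.Theory.
Import numFieldNormedType.Exports.

Local Open Scope classical_set_scope.
Local Open Scope ring_scope.

Section KolmogorovSinai.
Context d (T : measurableType d) (R : realType).
Variables (mu : probability T R) (f : T -> T).

Definition invariant_measure : Prop :=
  forall B, measurable B -> mu (f @^-1` B) = mu B.

(* The convention 0 log 0 = 0 holds because [ln 0 = 0]. *)
Definition partition_entropy (I : finType) (xi : I -> set T) : R :=
  - \sum_(i : I) fine (mu (xi i)) * ln (fine (mu (xi i))).

Definition measurable_partition (k : nat) (xi : 'I_k -> set T) : Prop :=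
  (forall i, measurable (xi i)) /\ partition [set: 'I_k] xi [set: T].

(* The atoms of xi v f^-1 xi v ... v f^-(n-1) xi, indexed by words of length n;
   some of them may be empty, and these do not contribute to the entropy. *)
Definition iterated_join (k : nat) (xi : 'I_k -> set T) (n : nat)
    (w : {ffun 'I_n -> 'I_k}) : set T :=
  \bigcap_(j in [set: 'I_n]) (iter j f @^-1` xi (w j)).

(* For an invariant measure this limit exists, by subadditivity. *)
Definition entropy_wrt (k : nat) (xi : 'I_k -> set T) : R :=
  lim ((n%:R^-1 * partition_entropy (@iterated_join k xi n)) @[n --> \oo]).

Definition KS_entropy : \bar R :=
  ereal_sup [set h | exists k, exists2 xi : 'I_k -> set T,
    measurable_partition xi & h = (entropy_wrt xi)%:E].

End KolmogorovSinai.

(* The alphabet {1, 2, 3} is encoded as 'I_3 = {0, 1, 2}. *)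
Definition full_shift : Type :=
  prod_topology (fun _ : nat => discrete_topology 'I_3).
HB.instance Definition _ := Topological.on full_shift.
HB.instance Definition _ := isPointed.Build full_shift (fun=> 0 : 'I_3).

Definition Omega := g_sigma_algebraType (@open full_shift).
HB.instance Definition _ := Measurable.on Omega.

Definition shift_map (x : Omega) : Omega := fun n => x n.+1.

Definition potential (R : realType) (eps : 'I_3 -> 'I_3 -> R) (x : Omega) : R :=
  - eps (x 0%N) (x 1%N).

(* The supremum is taken in \bar R; it is finite when A is bounded and
   measurable. *)
Definition pressure (R : realType) (A : Omega -> R) (beta : R) : R :=
  fine (ereal_sup [set p | exists2 mu : probability Omega R,
    invariant_measure mu shift_map &
    p = (KS_entropy mu shift_map + beta%:E * \int[mu]_x (A x)%:E)%E]).

(* Main.v *)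
(** For [beta > 0] the pressure is [ln lam], [lam] being the Perron eigenvalue of
    [M i j = expR (- beta * eps i j)].  The right and left eigenvectors of [M]
    are explicit and define a stationary Markov chain with transition matrix
    [Q], and [- ln Q] is cohomologous to [ln lam - beta * A].
    - Upper bound: given a partition [xi] and an invariant [mu], guess the
      [xi]-itinerary of a point from its symbolic word, using cylinder sets that
      approximate the atoms of [xi]; by Gibbs' inequality the entropy of the
      itinerary is at most the Markov code length of the word plus the cost of
      the guess, which is arbitrarily small per unit of time.
    - Lower bound: the Markov measure itself, obtained by pushing forward
      Lebesgue measure on [0, 1[ along a coding with interval cylinders.
    With [lam = 1 + t] the characteristic equation reads
    [t^2 kappa = t B + D], where [kappa] tends to 1 and [B], [D] are (up to a
    factor [kappa]) sums of exponentials.  Multiplying by [expR (2 rho beta)] with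
    [rho] the minimum of the decay rate of [B] and of half that of [D], the
    coefficients converge, not both to zero, and the quadratic formula gives the
    limit. *)

From HB Require Import structures.
Require Import Defs.
From mathcomp Require Import all_boot all_order all_algebra.
From mathcomp Require Import all_classical all_reals all_analysis.
From mathcomp Require Import measurable_realfun ring lra.

Set Implicit Arguments.
Unset Strict Implicit.
Unset Printing Implicit Defensive.

Import Order.TTheory GRing.Theory Num.Theory.
Import numFieldNormedType.Exports.

Local Open Scope classical_set_scope.
Local Open Scope ring_scope.

(** * Laws of finite-valued maps *)

Section FiniteValued.
Context d (T : measurableType d) (R : realType).
Implicit Types (mu : probability T R).

Definition finite_valued (I : finType) (X : T -> I) : Prop :=
  forall i, measurable (X @^-1` [set i]).

Definition law mu (I : finType) (X : T -> I) (i : I) : R :=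
  fine (mu (X @^-1` [set i])).

Lemma finite_valued_preimage (I : finType) (X : T -> I) (S : set I) :
  finite_valued X -> measurable (X @^-1` S).
Proof.
move=> mX; have -> : X @^-1` S = \bigcup_(i in S) (X @^-1` [set i]).
  by apply/seteqP; split => [x Sx|x [i Si]]; [exists (X x)|move=> /= ->].
by apply: fin_bigcup_measurable => // i _; exact: mX.
Qed.

Lemma finite_valued_comp (I J : finType) (f : I -> J) (X : T -> I) :
  finite_valued X -> finite_valued (f \o X).
Proof. by move=> mX j; exact: (finite_valued_preimage (f @^-1` [set j]) mX). Qed.

Lemma finite_valued_pair (I J : finType) (X : T -> I) (Y : T -> J) :
  finite_valued X -> finite_valued Y -> finite_valued (fun x => (X x, Y x)).
Proof.
move=> mX mY [i j]; rewrite (_ : _ @^-1` _ = X @^-1` [set i] `&` Y @^-1` [set j]).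
  exact: measurableI.
by apply/seteqP; split => x /= => [[-> ->]//|[-> ->]].
Qed.

Lemma finite_valued_ffun (J I : finType) (X : J -> T -> I) :
  (forall j, finite_valued (X j)) -> finite_valued (fun x => [ffun j => X j x]).
Proof.
move=> mX w; rewrite (_ : _ @^-1` _ = \bigcap_j (X j @^-1` [set w j])).
  by apply: fin_bigcap_measurable => // j _; exact: mX.
apply/seteqP; split => x /=; first by move=> <- j _ /=; rewrite ffunE.
by move=> Xw; apply/ffunP => j; rewrite ffunE; exact: Xw.
Qed.

Lemma law_ge0 mu (I : finType) (X : T -> I) i : 0 <= law mu X i.
Proof. exact: fine_ge0. Qed.

Lemma lawE mu (I : finType) (X : T -> I) i : finite_valued X ->
  (law mu X i)%:E = mu (X @^-1` [set i]).
Proof. by move=> mX; rewrite fineK// fin_num_measure. Qed.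

Lemma law_additive mu (I : finType) (X : T -> I) (s : seq I) :
  finite_valued X -> uniq s ->
  fine (mu (X @^-1` [set` s])) = \sum_(i <- s) law mu X i.
Proof.
move=> mX; elim: s => [_|i s IH /= /andP[nis us]].
  by rewrite big_nil (_ : _ @^-1` _ = set0) ?measure0//; apply/seteqP; split.
have -> : X @^-1` [set` i :: s] = (X @^-1` [set i]) `|` (X @^-1` [set` s]).
  apply/seteqP; split => x /=; first by rewrite inE => /orP[/eqP|]; [left|right].
  by case=> [-> | sX]; rewrite inE ?eqxx ?sX ?orbT.
rewrite measureU ?fineD ?fin_num_measure ?big_cons ?IH//;
  try exact: finite_valued_preimage.
by apply/seteqP; split => // x /= [-> si]; rewrite si in nis.
Qed.

Lemma law_preimage mu (I : finType) (X : T -> I) (P : pred I) :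
  finite_valued X -> fine (mu (X @^-1` [set i | P i])) = \sum_(i | P i) law mu X i.
Proof.
move=> mX; have := @law_additive mu I X (enum P) mX (enum_uniq _).
rewrite big_enum => <-; congr (fine (mu _)).
by apply/seteqP; split => x /=; rewrite mem_enum.
Qed.

Lemma law_comp mu (I J : finType) (f : I -> J) (X : T -> I) j :
  finite_valued X -> law mu (f \o X) j = \sum_(i | f i == j) law mu X i.
Proof.
move=> mX; rewrite -law_preimage//; congr (fine (mu _)).
by apply/seteqP; split => x /= /eqP.
Qed.

Lemma expect_comp mu (I J : finType) (f : I -> J) (X : T -> I) (G : J -> R) :
  finite_valued X ->
  \sum_j law mu (f \o X) j * G j = \sum_i law mu X i * G (f i).
Proof.
move=> mX; rewrite (partition_big f xpredT)//=; apply: eq_bigr => j _.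
rewrite law_comp// big_distrl /=; apply: eq_bigr => i /eqP ->.
by [].
Qed.

Lemma law_sum1 mu (I : finType) (X : T -> I) :
  finite_valued X -> \sum_i law mu X i = 1.
Proof.
move=> mX; rewrite -(@law_preimage mu I X xpredT mX) (_ : _ @^-1` _ = setT).
  by rewrite probability_setT.
by apply/seteqP; split.
Qed.

Lemma law_comp_ge mu (I J : finType) (f : I -> J) (X : T -> I) i :
  finite_valued X -> law mu X i <= law mu (f \o X) (f i).
Proof.
move=> mX; rewrite law_comp// (bigD1 i)//= lerDl.
by apply: sumr_ge0 => k _; exact: law_ge0.
Qed.

Lemma integral_finite_valued mu (I : finType) (X : T -> I) (F : I -> R) :
  finite_valued X ->
  (\int[mu]_x (F (X x))%:E = (\sum_i law mu X i * F i)%:E)%E.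
Proof.
move=> mX.
have mi i : mu.-integrable setT (fun x => (F i * \1_(X @^-1` [set i]) x)%:E).
  under eq_fun do rewrite EFinM.
  apply: integrableZl => //; exact: integrable_indic.
transitivity (\int[mu]_x (\sum_i (F i * \1_(X @^-1` [set i]) x)%:E))%E.
  apply: eq_integral => x _; rewrite sumEFin (bigD1 (X x))//= big1 ?addr0.
    by rewrite indicE mem_set ?mulr1.
  by move=> i iX; rewrite indicE memNset ?mulr0//= => /esym/eqP; exact/negP.
rewrite integral_sum// -sumEFin; apply: eq_bigr => i _.
under eq_integral do rewrite EFinM.
rewrite integralZl//; last first.
  exact: integrable_indic.
by rewrite integral_indic// setIT EFinM lawE// muleC.
Qed.

End FiniteValued.

(** * Approximation by cylinder sets *)

Definition word (n : nat) (x : Omega) : {ffun 'I_n -> 'I_3} :=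
  [ffun i : 'I_n => x i].

Lemma open_coordinate (j : nat) (i : 'I_3) :
  @open full_shift [set x | x j = i].
Proof.
have cj : continuous (fun x : full_shift => x j).
  exact: (@proj_continuous nat (fun=> discrete_topology 'I_3) j).
by apply: (proj1 (continuousP _) cj [set i]); exact: discrete_open.
Qed.

Lemma open_word (U : set full_shift) (x : full_shift) : open U -> U x ->
  exists n, forall y : full_shift, (forall i, (i < n)%N -> y i = x i) -> U y.
Proof.
move=> oU Ux.
pose base n := [set y : full_shift | forall i, (i < n)%N -> y i = x i].
pose F := filter_from setT base.
have FF : Filter F.
  apply: filter_from_filter => [|n m _ _]; first by exists 0%N.
  exists (maxn n m) => // y; rewrite /base /= => h; split => i im; apply: h;
    by rewrite leq_max im ?orbT.
suff : F --> x.
  move=> /(_ U) []; first exact: open_nbhs_nbhs.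
  by move=> n _ nU; exists n => y yx; exact: nU.
apply/cvg_sup => j A [B [[V oV VB] Bx BA]].
exists j.+1 => // y yx; apply: BA; rewrite -VB /=; move: Bx; rewrite -VB /=.
by rewrite yx.
Qed.

Lemma finite_valued_coordinate (j : nat) :
  finite_valued (fun x : Omega => x j : 'I_3).
Proof. by move=> i; apply: sub_sigma_algebra; exact: open_coordinate. Qed.

Lemma finite_valued_word n : finite_valued (@word n).
Proof. by apply: finite_valued_ffun => j; exact: finite_valued_coordinate. Qed.

Definition cylinder : set (set Omega) :=
  [set B | exists n (S : set {ffun 'I_n -> 'I_3}), B = @word n @^-1` S].

Definition subword n m (le_nm : (n <= m)%N) (w : {ffun 'I_m -> 'I_3}) :
  {ffun 'I_n -> 'I_3} := [ffun i => w (widen_ord le_nm i)].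

Lemma subword_word n m (le_nm : (n <= m)%N) x : subword le_nm (word m x) = word n x.
Proof. by apply/ffunP => i; rewrite !ffunE. Qed.

Lemma cylinder_widen n m (S : set {ffun 'I_n -> 'I_3}) : (n <= m)%N ->
  exists S' : set {ffun 'I_m -> 'I_3}, @word n @^-1` S = @word m @^-1` S'.
Proof.
move=> nm; exists (subword nm @^-1` S).
by apply/seteqP; split => x /=; rewrite subword_word.
Qed.

Lemma cylinder_common n m (S : set {ffun 'I_n -> 'I_3})
    (S' : set {ffun 'I_m -> 'I_3}) :
  exists k (U U' : set {ffun 'I_k -> 'I_3}),
  @word n @^-1` S = @word k @^-1` U /\ @word m @^-1` S' = @word k @^-1` U'.
Proof.
exists (maxn n m); have [U SU] := cylinder_widen S (leq_maxl n m).
by have [U' SU'] := cylinder_widen S' (leq_maxr n m); exists U, U'.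
Qed.

Lemma cylinder_setI_closed : setI_closed cylinder.
Proof.
move=> _ _ [n [S ->]] [m [S' ->]].
have [k [U [U' [-> ->]]]] := cylinder_common S S'.
by exists k, (U `&` U').
Qed.

Lemma measurable_Omega_cylinder : @measurable _ Omega = <<s cylinder >>.
Proof.
apply/seteqP; split.
- apply: smallest_sub; first exact: smallest_sigma_algebra.
  move=> U oU.
  have -> : U = \bigcup_n (@word n @^-1` [set w | @word n @^-1` [set w] `<=` U]).
    apply/seteqP; split => [x Ux|x [n _]] /=; last exact.
    have [n nU] := open_word oU Ux; exists n => //= y /= yx; apply: nU => i lin.
    by move/ffunP : yx => /(_ (Ordinal lin)); rewrite !ffunE.
  apply: sigma_algebra_bigcup => n; apply: sub_sigma_algebra.
  by exists n, [set w | @word n @^-1` [set w] `<=` U].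
- apply: smallest_sub; first exact: smallest_sigma_algebra.
  by move=> _ [n [S ->]]; exact: finite_valued_preimage (@finite_valued_word n).
Qed.

Section Approximation.
Context (R : realType) (mu : probability Omega R).

(* [E] contains the symmetric difference of [B] and a cylinder set. *)
Definition approximable (B : set Omega) : Prop := forall e : R, 0 < e ->
  exists n (S : set {ffun 'I_n -> 'I_3}) (E : set Omega),
  [/\ measurable E, fine (mu E) < e &
      forall x, ~ E x -> (B x <-> S (word n x))].

Lemma approximableU A B :
  approximable A -> approximable B -> approximable (A `|` B).
Proof.
move=> aA aB e e0; have e20 : 0 < e / 2 by rewrite divr_gt0.
have [n [S [E [mE muE AS]]]] := aA _ e20.
have [m [S' [E' [mE' muE' BS]]]] := aB _ e20.
have [k [U [U' [SU SU']]]] := cylinder_common S S'.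
exists k, (U `|` U'), (E `|` E'); split; first exact: measurableU.
- rewrite [ltRHS](splitr e); apply: (le_lt_trans _ (ltrD muE muE')).
  rewrite -fineD ?fin_num_measure// fine_le ?measureU2//.
  - by rewrite fin_num_measure//; exact: measurableU.
  - by rewrite fin_numD !fin_num_measure.
- move=> x /= /not_orP[Ex E'x].
  have -> : U (word k x) <-> S (word n x).
    by move/seteqP: SU => [h1 h2]; split; [apply: h2|apply: h1].
  have -> : U' (word k x) <-> S' (word m x).
    by move/seteqP: SU' => [h1 h2]; split; [apply: h2|apply: h1].
  by have := AS _ Ex; have := BS _ E'x; tauto.
Qed.

Lemma approximable_bigcup (F : nat -> set Omega) :
  (forall n, measurable (F n)) -> (forall n, approximable (F n)) ->
  approximable (\bigcup_n F n).
Proof.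
move=> mF aF e e0; have e20 : 0 < e / 2 by rewrite divr_gt0.
pose G n := \bigcup_(i < n) F i.
have mG n : measurable (G n) by exact: bigcup_measurable.
have aG n : approximable (G n).
  elim: n => [|n IH].
    rewrite /G (_ : `I_0 = set0) ?bigcup_set0; last by apply/seteqP; split.
    move=> d d0; exists 0%N, set0, set0; split => //; first by rewrite measure0.
  by rewrite /G bigcup_mkord big_ord_recr -bigcup_mkord /=; exact: approximableU.
have mT : measurable (\bigcup_n F n) by exact: bigcupT_measurable.
have mD n : measurable (\bigcup_n F n `\` G n) by exact: measurableD.
have : (mu \o (fun n => \bigcup_n F n `\` G n)) x @[x --> \oo] --> 0%:E.
  have D0 : \bigcap_n (\bigcup_n F n `\` G n) = set0.
    apply/seteqP; split => // x h; have [[i _ Fi] _] := h 0%N I.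
    by have [_] := h i.+1 I; apply; exists i => /=.
  have -> : 0%:E = mu (\bigcap_n (\bigcup_n F n `\` G n)) by rewrite D0 measure0.
  apply: nonincreasing_cvg_mu => //.
  - by rewrite (le_lt_trans (probability_le1 _ _))// ltry.
  - exact: bigcapT_measurable.
  - move=> n m nm; apply/subsetPset => x [Fx Gx]; split => //.
    by move: Gx; apply: contra_not => -[i /= ni Fi]; exists i => //=; exact: leq_trans nm.
move=> /fine_cvg /cvgr_lt /(_ _ e20) [n _ /(_ n (leqnn n)) /= muD].
have [m [S [E [mE muE GS]]]] := aG n _ e20.
exists m, S, (E `|` (\bigcup_n F n `\` G n)); split.
- exact: measurableU.
- rewrite [ltRHS](splitr e); apply: (le_lt_trans _ (ltrD muE muD)).
  rewrite -fineD ?fin_num_measure// fine_le ?measureU2//.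
  - by rewrite fin_num_measure//; exact: measurableU.
  - by rewrite fin_numD !fin_num_measure.
- move=> x /not_orP[Ex /not_andP Dx]; rewrite -GS//; split => [Fx|[i _ Fi]].
    by case: Dx => // /contrapT.
  by exists i.
Qed.

Lemma measurable_approximable (B : set Omega) : measurable B -> approximable B.
Proof.
rewrite measurable_Omega_cylinder => mB.
suff : [set A | measurable A /\ approximable A] B by case.
move: B mB; apply: smallest_sub; first split.
- split => // e e0; exists 0%N, set0, set0; split => //.
  by rewrite measure0.
- move=> A [mA aA]; split; first exact: measurableD.
  move=> e e0; have [n [S [E [mE muE AS]]]] := aA _ e0.
  exists n, (~` S), E; split => // x /AS [h1 h2]; split => /=.
    by case=> _ nA /h2.
  by move=> nS; split => // /h1.
- move=> F mF; split; first by apply: bigcupT_measurable => k; case: (mF k).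
  by apply: approximable_bigcup => k; case: (mF k).
- move=> _ [n [S ->]]; split.
    exact: finite_valued_preimage (@finite_valued_word n).
  move=> e e0; exists n, S, set0; split => //.
  by rewrite measure0.
Qed.

End Approximation.

(** * Markov measures *)

Lemma ord3P (i : 'I_3) : [\/ i = 0, i = 1 | i = 2].
Proof.
by case: i => [[|[|[|//]]] p]; [apply: Or31|apply: Or32|apply: Or33]; exact: val_inj.
Qed.

Lemma sum_ord3 (V : nmodType) (F : 'I_3 -> V) : \sum_i F i = F 0 + (F 1 + F 2).
Proof.
rewrite !big_ord_recl big_ord0 addr0.
by congr (F _ + (F _ + F _)); exact: val_inj.
Qed.

Definition head_letter (R : realType) (r : 'I_3 -> R) (u : R) : 'I_3 :=
  if u < r 0 then 0 else if u < r 0 + r 1 then 1 else 2.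

Definition lower_end (R : realType) (r : 'I_3 -> R) (s : 'I_3) : R :=
  if s == 0 then 0 else if s == 1 then r 0 else r 0 + r 1.

(* If [u] is uniform on [0, 1[, then the first letter [s] has law [r] and, given
   [s], the rescaled point is again uniform: the letters form a Markov chain. *)
Fixpoint coding (R : realType) (Q : 'I_3 -> 'I_3 -> R) (r : 'I_3 -> R) (u : R)
    (n : nat) : 'I_3 :=
  let s := head_letter r u in
  if n is m.+1 then coding Q (Q s) ((u - lower_end r s) / r s) m else s.

Fixpoint path_weight (R : realType) (Q : 'I_3 -> 'I_3 -> R) (r : 'I_3 -> R)
    (n : nat) (w : nat -> 'I_3) : R :=
  if n is m.+1 then r (w 0%N) * path_weight Q (Q (w 0%N)) m (fun j => w j.+1) else 1.

Definition positive_distribution (R : realType) (r : 'I_3 -> R) : Prop :=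
  (forall i, 0 < r i) /\ \sum_i r i = 1.

Section Coding.
Context (R : realType) (Q : 'I_3 -> 'I_3 -> R).
Hypothesis Q_pd : forall i, positive_distribution (Q i).
Implicit Types (r : 'I_3 -> R) (u : R).

Lemma head_letterP r u s : positive_distribution r -> 0 <= u < 1 ->
  (head_letter r u = s) <-> (lower_end r s <= u < lower_end r s + r s).
Proof.
case=> r0; rewrite sum_ord3 => r1 /andP[u0 u1].
have [[r00 r01] r02] := (r0 0, r0 1, r0 2); rewrite /head_letter /lower_end.
case: (ord3P s) => -> /=; case: (ltP u (r 0)) => h1; try case: (ltP u (r 0 + r 1)) => h2;
  split => //= h; first [exfalso; lra | lra].
Qed.

Lemma lower_end_ge0 r s : positive_distribution r ->
  0 <= lower_end r s /\ lower_end r s + r s <= 1.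
Proof.
case=> r0; rewrite sum_ord3 => r1.
have [[r00 r01] r02] := (r0 0, r0 1, r0 2); rewrite /lower_end.
by case: (ord3P s) => -> /=; split; lra.
Qed.

Lemma path_weight_gt0 n w r : positive_distribution r -> 0 < path_weight Q r n w.
Proof.
elim: n w r => [|n IH] w r rp //=.
by apply: mulr_gt0; [case: rp|exact: IH].
Qed.

Lemma coding_interval n w r : positive_distribution r ->
  exists l, [/\ 0 <= l, l + path_weight Q r n w <= 1 & forall u, 0 <= u < 1 ->
    ((forall j, (j < n)%N -> coding Q r u j = w j) <->
     l <= u < l + path_weight Q r n w)].
Proof.
elim: n w r => [|n IH] w r rp.
  by exists 0; rewrite /= add0r; split.
have [l [l0 l1 lP]] := IH (fun j => w j.+1) _ (Q_pd (w 0%N)).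
have [e0 e1] := lower_end_ge0 (w 0%N) rp.
have r0 : 0 < r (w 0%N) by case: rp.
set p := path_weight Q (Q (w 0%N)) n (fun j => w j.+1) in l1 lP *.
have p0 : 0 < p by exact: path_weight_gt0.
exists (lower_end r (w 0%N) + r (w 0%N) * l); split => /=; rewrite -/p.
- by rewrite addr_ge0// mulr_ge0// ltW.
- by rewrite -addrA -mulrDr (le_trans _ e1)// lerD2l ger_pMr.
move=> u u01; have H := head_letterP (w 0%N) rp u01.
set u' := (u - lower_end r (w 0%N)) / r (w 0%N).
have uE : u = lower_end r (w 0%N) + r (w 0%N) * u' by rewrite /u'; field; rewrite gt_eqF.
have step : (lower_end r (w 0%N) <= u < lower_end r (w 0%N) + r (w 0%N)) = (0 <= u' < 1).
  rewrite [in LHS]uE lerDl pmulr_rge0// ltrD2l.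
  by rewrite -[X in _ && (_ < X) = _]mulr1 ltr_pM2l.
have goal : (lower_end r (w 0%N) + r (w 0%N) * l <= u <
   lower_end r (w 0%N) + r (w 0%N) * l + r (w 0%N) * p) = (l <= u' < l + p).
  by rewrite [in LHS]uE -addrA -mulrDr lerD2l ltrD2l ler_pM2l// ltr_pM2l.
rewrite goal; split.
  move=> h; have h0 : head_letter r u = w 0%N by exact: (h 0%N).
  have u'01 : 0 <= u' < 1 by rewrite -step; exact/H.
  apply/(lP _ u'01) => j jn; have := h j.+1 jn; rewrite /= h0.
  by [].
move=> lu; have u'01 : 0 <= u' < 1.
  by move/andP: lu => [a b]; rewrite (le_trans l0 a) (lt_le_trans b l1).
have h0 : head_letter r u = w 0%N by apply/H; rewrite step.
move=> [|j] jn //=; rewrite h0; have [_ /(_ lu)] := lP _ u'01; exact.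
Qed.

Lemma finite_valued_head_letter r : finite_valued (head_letter r : measurableTypeR R -> _).
Proof.
pose X := fun u : measurableTypeR R => (u < r 0, u < r 0 + r 1).
have mlt (c : R) : finite_valued (fun u : measurableTypeR R => u < c).
  move=> b; rewrite (_ : _ @^-1` _ = if b then `]-oo, c[%classic else `[c, +oo[%classic).
    by case: b.
  by apply/seteqP; split => u /=; case: b => /=; rewrite in_itv/= ?andbT ?leNgt; case: (u < c).
rewrite (_ : head_letter r = (fun b => if b.1 then 0 else if b.2 then 1 else 2) \o X)//.
by apply: finite_valued_comp; exact: finite_valued_pair.
Qed.

Lemma finite_valued_coding n r :
  finite_valued ((fun u => coding Q r u n) : measurableTypeR R -> _).
Proof.
elim: n r => [|n IH] r; first exact: finite_valued_head_letter.
move=> i.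
rewrite (_ : _ @^-1` _ = \bigcup_s ((head_letter r @^-1` [set s]) `&`
   ((fun u => (u - lower_end r s) / r s) @^-1` ((fun u => coding Q (Q s) u n) @^-1` [set i])))).
  apply: fin_bigcup_measurable => // s _; apply: measurableI.
    exact: finite_valued_head_letter.
  rewrite -[X in measurable X]setTI.
  have : measurable_fun setT ((fun u => (u - lower_end r s) / r s) :
      measurableTypeR R -> measurableTypeR R).
    apply: measurable_funM => //; exact: measurable_funB.
  by apply => //; exact: IH.
apply/seteqP; split => u /=; first by exists (head_letter r u).
by case=> s _ /= [-> ].
Qed.

End Coding.
Section Code.
Context (R : realType) (Q : 'I_3 -> 'I_3 -> R) (r : 'I_3 -> R).

Definition code (u : measurableTypeR R) : Omega := coding Q r u.

Lemma measurable_code : measurable_fun setT code.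
Proof.
apply: (measurability _ measurable_Omega_cylinder) => _ [_ [n [S ->]] <-].
rewrite setTI.
have fv := finite_valued_ffun (fun j : 'I_n => finite_valued_coding Q j r).
exact: (finite_valued_preimage S fv).
Qed.

End Code.

Section UnitLebesgue.
Context (R : realType).

Definition unit_lebesgue : set (measurableTypeR R) -> \bar R :=
  mrestr (@lebesgue_measure R) (measurable_itv `[0, 1[).

HB.instance Definition _ := Measure.on unit_lebesgue.

Let unit_lebesgue_setT : unit_lebesgue setT = 1%E.
Proof.
rewrite /unit_lebesgue /mrestr setTI lebesgue_measure_itv /= lte_fin ltr01.
by rewrite oppr0 adde0.
Qed.

HB.instance Definition _ :=
  Measure_isProbability.Build _ _ _ unit_lebesgue unit_lebesgue_setT.

End UnitLebesgue.

Section MarkovMeasure.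
Context (R : realType) (Q : 'I_3 -> 'I_3 -> R) (r : 'I_3 -> R).
Hypothesis Q_pd : forall i, positive_distribution (Q i).
Hypothesis r_pd : positive_distribution r.

Lemma markov_measure_exists : exists nu : probability Omega R,
  forall n w, fine (nu [set x | forall j, (j < n)%N -> x j = w j]) =
              path_weight Q r n w.
Proof.
pose X : {mfun measurableTypeR R >-> Omega} := mfun_Sub (mem_set (measurable_code Q r)).
exists (distribution (@unit_lebesgue R) X) => n w.
have [l [l0 l1 lP]] := coding_interval Q_pd n w r_pd.
rewrite /distribution /pushforward /= /unit_lebesgue /mrestr.
rewrite (_ : _ `&` _ = `[l, l + path_weight Q r n w[%classic); last first.
  apply/seteqP; split => u /=.
    by rewrite !in_itv/= => -[h u01]; apply/(lP _ u01).
  rewrite !in_itv/= => h; have u01 : 0 <= u < 1.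
    by case/andP: h => a b; rewrite (le_trans l0 a) (lt_le_trans b l1).
  by split => //; exact/(lP _ u01).
rewrite lebesgue_measure_itv /= lte_fin ltrDl path_weight_gt0//= addrAC subrr add0r.
by [].
Qed.

End MarkovMeasure.

Lemma iter_shift (j i : nat) (x : Omega) : iter j shift_map x i = x (i + j)%N.
Proof. by elim: j i => [|j IH] i; rewrite ?addn0// iterS /shift_map IH addSnnS. Qed.

Lemma word_shift n (x : Omega) :
  word n (shift_map x) = [ffun i => word n.+1 x (lift ord0 i)].
Proof. by apply/ffunP => i; rewrite !ffunE. Qed.

Lemma measurable_shift : measurable_fun setT shift_map.
Proof.
apply: (measurability _ measurable_Omega_cylinder) => _ [_ [n [S ->]] <-].
rewrite setTI.
rewrite (_ : shift_map @^-1` _ = @word n.+1 @^-1`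
    [set w | S [ffun i => w (lift ord0 i)]]).
  exact: (finite_valued_preimage _ (@finite_valued_word n.+1)).
by apply/seteqP; split => x /=; rewrite word_shift.
Qed.

Lemma finite_valued_iter_shift (I : finType) (X : Omega -> I) j :
  finite_valued X -> finite_valued (X \o iter j shift_map).
Proof.
move=> mX; elim: j => [//|j IH] i.
rewrite (_ : _ @^-1` _ = setT `&` shift_map @^-1` ((X \o iter j shift_map) @^-1` [set i])).
  exact: (measurable_shift measurableT (IH i)).
by rewrite setTI; apply/seteqP; split => x /=; rewrite -iterSr.
Qed.

Lemma law_iter_shift (R : realType) (mu : probability Omega R) (I : finType)
    (X : Omega -> I) j :
  invariant_measure mu shift_map -> finite_valued X ->
  law mu (X \o iter j shift_map) = law mu X.
Proof.
move=> inv mX; elim: j => [//|j <-]; apply/funext => i.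
rewrite /law -(inv _ (finite_valued_iter_shift j mX i)).
congr (fine (mu _)); apply/seteqP; split => x /=; by rewrite -iterSr.
Qed.

Definition word_ext n (w : {ffun 'I_n -> 'I_3}) (j : nat) : 'I_3 :=
  if insub j is Some i then w i else 0.

Lemma word_extE n (w : {ffun 'I_n -> 'I_3}) (i : 'I_n) : word_ext w i = w i.
Proof. by rewrite /word_ext valK. Qed.

Lemma word_ext_word n (x : Omega) j : (j < n)%N -> word_ext (word n x) j = x j.
Proof. by move=> jn; rewrite -[j]/(val (Ordinal jn)) word_extE ffunE. Qed.

Lemma path_weightS (R : realType) (Q : 'I_3 -> 'I_3 -> R) r n w :
  path_weight Q r n.+1 w = r (w 0%N) * \prod_(j < n) Q (w j) (w j.+1).
Proof.
elim: n w r => [|n IH] w r; first by rewrite big_ord0.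
transitivity (r (w 0%N) * path_weight Q (Q (w 0%N)) n.+1 (fun j => w j.+1)); first by [].
by rewrite IH big_ord_recl.
Qed.

Section MarkovLaw.
Context (R : realType) (Q : 'I_3 -> 'I_3 -> R) (r : 'I_3 -> R).
Variable nu : probability Omega R.
Hypothesis nuE : forall n w, fine (nu [set x | forall j, (j < n)%N -> x j = w j]) =
              path_weight Q r n w.

Lemma law_markov_word n w : law nu (@word n) w = path_weight Q r n (word_ext w).
Proof.
rewrite -nuE /law; congr (fine (nu _)); apply/seteqP; split => x /=.
  by move=> <- j jn; rewrite word_ext_word.
by move=> h; apply/ffunP => i; rewrite ffunE h// word_extE.
Qed.

Lemma markov_invariant : \sum_i r i = 1 ->
  (forall j, \sum_i r i * Q i j = r j) -> invariant_measure nu shift_map.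
Proof.
move=> r1 rQ.
have stat n w : \sum_i r i * path_weight Q (Q i) n w = path_weight Q r n w.
  case: n => [|n]; first by under eq_bigr do rewrite mulr1; rewrite r1.
  by rewrite /= -rQ big_distrl /=; apply: eq_bigr => i _; rewrite mulrA.
have lawS n w : law nu (@word n \o shift_map) w = law nu (@word n) w.
  pose X (x : Omega) := (x 0%N : 'I_3, word n (shift_map x)).
  have fvp : finite_valued X.
    apply: finite_valued_pair; first exact: finite_valued_coordinate.
    exact: (finite_valued_iter_shift 1 (@finite_valued_word n)).
  rewrite [in LHS](_ : _ \o _ = snd \o X)//.
  rewrite law_comp// (_ : \sum_(_ | _) _ = \sum_i law nu X (i, w)); last first.
    rewrite (reindex (fun i => (i, w))); first by apply: eq_bigl => i; rewrite eqxx.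
    by exists fst => // -[a b] /eqP /= ->.
  rewrite law_markov_word -stat; apply: eq_bigr => i _.
  pose iw j := if j is j'.+1 then word_ext w j' else i.
  rewrite -[RHS]/(path_weight Q r n.+1 iw) -nuE; congr (fine (nu _)).
  apply/seteqP; split => x /=.
    by move=> [xi xw] [|j] //= jn; rewrite -xw word_ext_word.
  move=> h; congr pair; first exact: (h 0%N).
  by apply/ffunP => j; rewrite ffunE /shift_map (h j.+1)//= ?word_extE// ltnS.
have mS := measurable_shift.
move=> B mB.
pose S : {mfun Omega >-> Omega} := mfun_Sub (mem_set mS).
suff : distribution nu S B = nu B by [].
apply: (measure_unique cylinder (fun=> setT) measurable_Omega_cylinder cylinder_setI_closed) => //.
- by move=> _; exists 0%N, setT; rewrite preimage_setT.
- by apply/seteqP; split => // x _; exists 0%N.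
- move=> _ [n [U ->]].
  have mU : measurable (@word n @^-1` U).
    exact: finite_valued_preimage (@finite_valued_word n).
  have fvs : finite_valued (@word n \o shift_map).
    exact: (finite_valued_iter_shift 1 (@finite_valued_word n)).
  have mSU := finite_valued_preimage U fvs.
  rewrite /distribution /pushforward /=.
  rewrite -[LHS]fineK ?fin_num_measure// -[RHS]fineK ?fin_num_measure//; congr EFin.
  have eU : U = [set i | `[< U i >]] by apply/seteqP; split => i /= /asboolP.
  have lawU X : finite_valued X ->
      fine (nu (X @^-1` U)) = \sum_(i | `[< U i >]) law nu X i.
    by move=> mX; rewrite -law_preimage// -eU.
  rewrite (lawU _ (@finite_valued_word n)).
  rewrite -[LHS]/(fine (nu ((@word n \o shift_map) @^-1` U))) lawU//.
  by apply: eq_bigr => w _; exact: lawS.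
- by move=> _; rewrite (le_lt_trans (probability_le1 _ _))// ltry.
Qed.

End MarkovLaw.

(** * Entropy *)

Lemma gibbs_inequality (R : realType) (I : finType) (p q : I -> R) :
  (forall i, 0 <= p i) -> (forall i, 0 < q i) -> \sum_i p i = 1 ->
  \sum_i q i <= 1 -> \sum_i p i * ln (q i) <= \sum_i p i * ln (p i).
Proof.
move=> p0 q0 p1 q1; rewrite -subr_ge0 -sumrB.
apply: (@le_trans _ _ (\sum_i (p i - q i))); first by rewrite sumrB p1 subr_ge0.
apply: ler_sum => i _; have := p0 i; rewrite le_eqVlt => /predU1P[<-|pi].
  by rewrite !mul0r !subr0 sub0r oppr_le0 ltW.
have qp0 : 0 < q i / p i by rewrite divr_gt0.
have : ln (1 + (q i / p i - 1)) <= q i / p i - 1 by apply: le_ln1Dx; lra.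
rewrite addrC subrK ln_div ?posrE// => h.
rewrite -mulrBr -ler_pdivrMl//; move: h; rewrite mulrBr mulVf ?gt_eqF// (mulrC _ (q i)).
lra.
Qed.

Lemma ln_prod (R : realType) (I : finType) (F : I -> R) :
  (forall i, 0 < F i) -> ln (\prod_i F i) = \sum_i ln (F i).
Proof.
move=> F0; suff [] : 0 < \prod_i F i /\ ln (\prod_i F i) = \sum_i ln (F i) by [].
elim/big_rec2: _ => [|i y x _ [x0 <-]]; first by rewrite ln1.
by rewrite lnM ?posrE// mulr_gt0.
Qed.

Section Itineraries.
Context (R : realType) (mu : probability Omega R) (k : nat).
Context (idx : Omega -> 'I_k).
Hypothesis m_idx : finite_valued idx.

Definition itinerary n (x : Omega) : {ffun 'I_n -> 'I_k} :=
  [ffun j : 'I_n => idx (iter j shift_map x)].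

Lemma finite_valued_itinerary n : finite_valued (itinerary n).
Proof. by apply: finite_valued_ffun => j; exact: finite_valued_iter_shift. Qed.

Lemma partition_entropy_itinerary (xi : 'I_k -> set Omega) n :
  (forall x i, idx x = i <-> xi i x) ->
  partition_entropy mu (@iterated_join _ Omega shift_map k xi n) =
  - \sum_w law mu (itinerary n) w * ln (law mu (itinerary n) w).
Proof.
move=> idxP; rewrite /partition_entropy; congr (- _); apply: eq_bigr => w _.
suff -> : iterated_join shift_map xi w = itinerary n @^-1` [set w] by [].
apply/seteqP; split => x /=.
  by move=> h; apply/ffunP => j; rewrite ffunE; apply/idxP; exact: h.
by move=> <- j _ /=; apply/idxP; rewrite ffunE.
Qed.

End Itineraries.

Lemma measurable_partition_index (k : nat) (xi : 'I_k -> set Omega) :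
  measurable_partition xi ->
  exists2 idx : Omega -> 'I_k, finite_valued idx & forall x i, idx x = i <-> xi i x.
Proof.
case=> mxi [cov /trivIsetP triv _].
have ex x : exists i, xi i x.
  by have : [set: Omega] x by []; rewrite -cov => -[i _ xix]; exists i.
have [idx idxP] := choice ex.
have H x i : idx x = i <-> xi i x.
  split => [<-|xix]; first exact: idxP.
  apply/eqP/negP => /negP ne; have := triv _ _ I I ne.
  by move/seteqP => [/(_ x) + _]; apply; split => //; exact: idxP.
exists idx => // i; rewrite (_ : _ @^-1` _ = xi i)//.
by apply/seteqP; split => x /H.
Qed.

Section CrossEntropy.
Context (R : realType) (mu : probability Omega R).
Context (Q : 'I_3 -> 'I_3 -> R) (r : 'I_3 -> R).
Hypothesis mu_inv : invariant_measure mu shift_map.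
Hypothesis Q_pd : forall i, positive_distribution (Q i).
Hypothesis r_pd : positive_distribution r.

Definition letter_pair (x : Omega) : 'I_3 * 'I_3 := (x 0%N, x 1%N).

Lemma finite_valued_letter_pair : finite_valued letter_pair.
Proof. by apply: finite_valued_pair; exact: finite_valued_coordinate. Qed.

Lemma markov_cross_entropy n :
  \sum_w law mu (@word n.+1) w * ln (path_weight Q r n.+1 (word_ext w)) =
  \sum_i law mu (fun x : Omega => x 0%N : 'I_3) i * ln (r i) +
  n%:R * \sum_z law mu letter_pair z * ln (Q z.1 z.2).
Proof.
have mw := @finite_valued_word n.+1.
transitivity (\sum_w (law mu (@word n.+1) w * ln (r (word_ext w 0%N)) +
   \sum_(j < n) law mu (@word n.+1) w * ln (Q (word_ext w j) (word_ext w j.+1)))).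
  apply: eq_bigr => w _; rewrite path_weightS lnM ?posrE; last 2 first.
  - by case: r_pd.
  - by apply: prodr_gt0 => j _; case: (Q_pd (word_ext w j)).
  rewrite mulrDr -big_distrr /=; congr (_ + _ * _).
  by apply: ln_prod => j; case: (Q_pd (word_ext w j)).
rewrite big_split /= exchange_big /=; congr (_ + _).
  rewrite -(expect_comp mu (fun w => word_ext w 0%N) (fun i => ln (r i)) mw).
  apply: eq_bigr => i _; congr (law mu _ _ * _).
  by apply/funext => x /=; rewrite word_ext_word.
rewrite -[n in n%:R]card_ord -sum1_card natr_sum big_distrl /=.
apply: eq_bigr => j _; rewrite mul1r.
rewrite -(expect_comp mu (fun w => (word_ext w j, word_ext w j.+1))
  (fun z => ln (Q z.1 z.2)) mw).
apply: eq_bigr => z _; congr (_ * _).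
rewrite -(law_iter_shift j mu_inv finite_valued_letter_pair); congr (law mu _ _).
apply/funext => x /=; rewrite /letter_pair !iter_shift.
by rewrite !word_ext_word ?ltnS// ltnW.
Qed.

End CrossEntropy.

Arguments path_weight : simpl never.

Lemma measurable_family_approximable (R : realType) (mu : probability Omega R)
    (I : finType) (B : I -> set Omega) (e : R) :
  (forall i, measurable (B i)) -> 0 < e ->
  exists m (C : I -> set {ffun 'I_m -> 'I_3}) (E : set Omega),
  [/\ measurable E, fine (mu E) < e &
      forall x i, ~ E x -> (B i x <-> C i (word m x))].
Proof.
move=> mB; suff H (s : seq I) : 0 < e ->
  exists m (C : I -> set {ffun 'I_m -> 'I_3}) (E : set Omega),
  [/\ measurable E, fine (mu E) < e &
      forall x i, i \in s -> ~ E x -> (B i x <-> C i (word m x))].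
  move=> /(H (enum I)) [m [C [E [mE muE EP]]]]; exists m, C, E; split => // x i.
  by apply: EP; rewrite mem_enum.
elim: s e => [|i s IH] e e0.
  by exists 0%N, (fun=> set0), set0; split => //; rewrite measure0.
have e20 : 0 < e / 2 by rewrite divr_gt0.
have [m [C [E [mE muE EP]]]] := IH _ e20.
have [m' [C' [E' [mE' muE' EP']]]] := measurable_approximable mu (mB i) e20.
have le_m := leq_maxl m m'; have le_m' := leq_maxr m m'.
exists (maxn m m').
exists (fun a => if a == i then subword le_m' @^-1` C' else subword le_m @^-1` C a).
exists (E `|` E'); split; first exact: measurableU.
- rewrite [ltRHS](splitr e); apply: (le_lt_trans _ (ltrD muE muE')).
  rewrite -fineD ?fin_num_measure// fine_le ?measureU2//.
  - by rewrite fin_num_measure//; exact: measurableU.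
  - by rewrite fin_numD !fin_num_measure.
- move=> x a; rewrite inE => ais /= /not_orP[Ex E'x].
  case: eqP ais => [-> _|_ /= ais] /=; rewrite subword_word; first exact: EP'.
  exact: EP.
Qed.

Section UpperBound.
Context (R : realType) (mu : probability Omega R) (k : nat).
Context (idx : Omega -> 'I_k).
Context (Q : 'I_3 -> 'I_3 -> R) (r : 'I_3 -> R).
Hypothesis mu_inv : invariant_measure mu shift_map.
Hypothesis m_idx : finite_valued idx.
Hypothesis Q_pd : forall i, positive_distribution (Q i).
Hypothesis r_pd : positive_distribution r.

Section Kernel.
Context (m : nat) (C : 'I_k -> set {ffun 'I_m -> 'I_3}) (delta : R).
Hypothesis delta_gt0 : 0 < delta.
Hypothesis delta_le1 : delta <= 1.

Definition guess_weight (b : {ffun 'I_m -> 'I_3}) (i : 'I_k) : R :=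
  if `[< C i b >] then 1 else delta.

Definition guess (b : {ffun 'I_m -> 'I_3}) (i : 'I_k) : R :=
  guess_weight b i / \sum_j guess_weight b j.

Lemma guess_weight_gt0 b i : 0 < guess_weight b i.
Proof. by rewrite /guess_weight; case: ifP. Qed.

Lemma guess_weight_sum_gt0 b : 0 < \sum_j guess_weight b j.
Proof.
rewrite (bigD1 (idx point))//= ltr_pwDl ?guess_weight_gt0//.
by apply: sumr_ge0 => j _; rewrite ltW// guess_weight_gt0.
Qed.

Lemma guess_gt0 b i : 0 < guess b i.
Proof. by rewrite divr_gt0 ?guess_weight_gt0 ?guess_weight_sum_gt0. Qed.

Lemma guess_sum1 b : \sum_i guess b i = 1.
Proof. by rewrite -mulr_suml divff// gt_eqF// guess_weight_sum_gt0. Qed.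

Definition context_and_index (x : Omega) := (word m x, idx x).

Lemma finite_valued_context_and_index : finite_valued context_and_index.
Proof. by apply: finite_valued_pair => //; exact: finite_valued_word. Qed.

Lemma guess_cost (E : set Omega) : measurable E ->
  (forall x i, ~ E x -> (idx x = i <-> C i (word m x))) ->
  - (\sum_z law mu context_and_index z * ln (guess z.1 z.2)) <=
  ln (1 + k%:R * delta) + fine (mu E) * ln (k%:R / delta).
Proof.
move=> mE EP.
have k0 : (0 < k)%N by have := idx point; case: (k) => [[]//|].
have kR : 1 <= k%:R :> R by rewrite ler1n.
have kd : 1 <= k%:R / delta by rewrite ler_pdivlMr// mul1r (le_trans delta_le1).
pose good (z : {ffun 'I_m -> 'I_3} * 'I_k) :=
  `[< forall i, C i z.1 <-> i = z.2 >].
have le1 z : good z -> - ln (guess z.1 z.2) <= ln (1 + k%:R * delta).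
  move=> /asboolP gz; have gz2 : guess_weight z.1 z.2 = 1.
    by rewrite /guess_weight; case: asboolP => // -[]; exact/gz.
  rewrite /guess gz2 mul1r lnV ?posrE ?guess_weight_sum_gt0// opprK.
  rewrite ler_ln ?posrE ?guess_weight_sum_gt0//; last by rewrite ltr_pwDl// mulr_ge0// ltW.
  rewrite (bigD1 z.2)//= gz2 lerD2l mulr_natl -[k in _ *+ k]card_ord -sumr_const.
  rewrite [leRHS](bigD1 z.2)//= -[leLHS]add0r lerD ?(ltW delta_gt0)//.
  apply: ler_sum => i /eqP iz; rewrite /guess_weight; case: asboolP => // /gz //.
have le2 z : - ln (guess z.1 z.2) <= ln (k%:R / delta).
  rewrite -lnV ?posrE ?guess_gt0// /guess invf_div.
  rewrite ler_ln ?posrE ?divr_gt0 ?guess_weight_gt0 ?guess_weight_sum_gt0 ?ltr0n//.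
  rewrite ler_pM ?(ltW (guess_weight_sum_gt0 _)) ?invr_ge0 ?(ltW (guess_weight_gt0 _ _))//.
    rewrite -[k in leRHS]card_ord -sum1_card natr_sum.
    by apply: ler_sum => j _; rewrite /guess_weight; case: ifP.
  rewrite lef_pV2 ?posrE ?guess_weight_gt0// /guess_weight; case: ifP => //.
have ln1 : 0 <= ln (1 + k%:R * delta).
  by apply: ln_ge0; rewrite lerDl mulr_ge0// ltW.
have mY := finite_valued_context_and_index.
have badE : \sum_(z | ~~ good z) law mu context_and_index z <= fine (mu E).
  rewrite -law_preimage//.
  have mb : measurable (context_and_index @^-1` [set z | ~~ good z]).
    exact: finite_valued_preimage.
  rewrite fine_le ?fin_num_measure// le_measure ?inE// => x /= /asboolPn ngood.
  apply: contrapT => Ex; apply: ngood => i; have [h1 h2] := EP x i Ex.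
  by split => [/h2 <-|/esym].
rewrite -sumrN (bigID good)/= lerD//.
  apply: (@le_trans _ _ (\sum_(z | good z)
    law mu context_and_index z * ln (1 + k%:R * delta))).
    by apply: ler_sum => z gz; rewrite -mulrN ler_wpM2l ?law_ge0 ?le1.
  rewrite -mulr_suml ler_piMl// -(law_sum1 mu mY) [leRHS](bigID good)/= lerDl.
  by apply: sumr_ge0 => z _; exact: law_ge0.
apply: (@le_trans _ _ (\sum_(z | ~~ good z)
  law mu context_and_index z * ln (k%:R / delta))).
  by apply: ler_sum => z gz; rewrite -mulrN ler_wpM2l ?law_ge0 ?le2.
by rewrite -mulr_suml ler_wpM2r// ln_ge0.
Qed.

Definition subblock N (a : {ffun 'I_N -> 'I_3}) (j : nat) : {ffun 'I_m -> 'I_3} :=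
  [ffun i : 'I_m => word_ext a (i + j)].

Lemma subblock_word N j x : (j + m <= N)%N ->
  subblock (word N x) j = word m (iter j shift_map x).
Proof.
move=> jm; apply/ffunP => i; rewrite !ffunE word_ext_word ?iter_shift//.
by rewrite addnC (leq_trans _ jm)// ltn_add2l.
Qed.

Definition joint n (x : Omega) := (itinerary idx n.+1 x, word (n + m).+1 x).

(* The law of a Markov word from which the letters of the itinerary are guessed
   independently, each from a window of length [m]. *)
Definition reference_weight n
    (z : {ffun 'I_n.+1 -> 'I_k} * {ffun 'I_(n + m).+1 -> 'I_3}) : R :=
  path_weight Q r (n + m).+1 (word_ext z.2) *
  \prod_(j < n.+1) guess (subblock z.2 j) (z.1 j).

Lemma reference_weight_gt0 n z : 0 < @reference_weight n z.
Proof.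
rewrite mulr_gt0 ?path_weight_gt0//.
by apply: prodr_gt0 => j _; exact: guess_gt0.
Qed.

Lemma path_weight_sum1 N :
  \sum_(a : {ffun 'I_N -> 'I_3}) path_weight Q r N (word_ext a) = 1.
Proof.
have [nu nuE] := markov_measure_exists Q_pd r_pd.
rewrite -(law_sum1 nu (@finite_valued_word N)).
by apply: eq_bigr => a _; rewrite (law_markov_word nuE).
Qed.

Lemma reference_weight_sum1 n : \sum_z @reference_weight n z = 1.
Proof.
rewrite -(path_weight_sum1 (n + m).+1).
rewrite -(pair_big xpredT xpredT (fun w a => reference_weight (w, a)))/=.
rewrite exchange_big; apply: eq_bigr => a _.
rewrite /reference_weight /= -big_distrr /=.
rewrite -(bigA_distr_bigA (fun j : 'I_n.+1 => guess (subblock a j))).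
by rewrite big1 ?mulr1// => j _; rewrite guess_sum1.
Qed.

Lemma finite_valued_joint n : finite_valued (joint n).
Proof.
by apply: finite_valued_pair; [exact: finite_valued_itinerary|exact: finite_valued_word].
Qed.

Lemma itinerary_entropy_le_joint n :
  - \sum_w law mu (itinerary idx n.+1) w * ln (law mu (itinerary idx n.+1) w) <=
  - \sum_z law mu (joint n) z * ln (law mu (joint n) z).
Proof.
have mJ := @finite_valued_joint n.
rewrite lerN2 (_ : itinerary idx n.+1 = fst \o joint n)//.
rewrite (expect_comp mu fst (fun w => ln (law mu (fst \o joint n) w)) mJ).
apply: ler_sum => z _; have := law_ge0 mu (joint n) z.
rewrite le_eqVlt => /predU1P[<-|p0]; first by rewrite !mul0r.
rewrite ler_pM2l// ler_ln ?posrE// ?law_comp_ge//.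
by apply: (lt_le_trans p0); exact: law_comp_ge.
Qed.

Lemma itinerary_entropy_le n :
  - \sum_w law mu (itinerary idx n.+1) w * ln (law mu (itinerary idx n.+1) w) <=
  - (\sum_i law mu (fun x : Omega => x 0%N : 'I_3) i * ln (r i)) -
  (n + m)%:R * (\sum_z law mu letter_pair z * ln (Q z.1 z.2)) -
  n.+1%:R * (\sum_z law mu context_and_index z * ln (guess z.1 z.2)).
Proof.
have mJ := @finite_valued_joint n.
apply: (le_trans (itinerary_entropy_le_joint n)).
rewrite -!opprD lerN2; apply: (@le_trans _ _
  (\sum_z law mu (joint n) z * ln (@reference_weight n z))); last first.
  apply: gibbs_inequality.
  - by move=> z; exact: law_ge0.
  - exact: reference_weight_gt0.
  - exact: law_sum1.
  - by rewrite reference_weight_sum1.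
rewrite -markov_cross_entropy//.
rewrite (_ : word (n + m).+1 = snd \o joint n)//.
rewrite (expect_comp mu snd (fun a => ln (path_weight Q r (n + m).+1 (word_ext a))) mJ).
rewrite [X in _ + X <= _](_ : _ = \sum_(j < n.+1) \sum_z
  law mu (joint n) z * ln (guess (subblock z.2 j) (z.1 j))); last first.
  rewrite mulr_natl -[X in _ *+ X]card_ord -sumr_const; apply: eq_bigr => j _.
  rewrite -(expect_comp mu (fun z : {ffun 'I_n.+1 -> 'I_k} * {ffun 'I_(n + m).+1 -> 'I_3} =>
    (subblock z.2 j, z.1 j)) (fun z => ln (guess z.1 z.2)) mJ).
  apply: eq_bigr => z _; congr (_ * _).
  rewrite -(law_iter_shift j mu_inv finite_valued_context_and_index); congr (law mu _ _).
  apply/funext => x /=; rewrite /context_and_index subblock_word ?ffunE//.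
  by rewrite -addSn leq_add2r ltnW.
rewrite exchange_big /= -big_split /= ler_sum// => z _.
rewrite -mulr_sumr -mulrDr /reference_weight lnM ?ln_prod//.
- by move=> j; exact: guess_gt0.
- by rewrite posrE path_weight_gt0.
- by rewrite posrE; apply: prodr_gt0 => j _; exact: guess_gt0.
Qed.

End Kernel.
End UpperBound.

Lemma cvg_affine_div (R : realType) (c h : R) :
  (n.+1%:R^-1 * (c + n.+1%:R * h)) @[n --> \oo] --> h.
Proof.
rewrite (_ : (fun n => _) = (fun n => c * n.+1%:R^-1 + h)); last first.
  by apply/funext => n; field; rewrite nat1r pnatr_eq0.
rewrite -[X in _ --> X](_ : c * 0 + h = h); last by rewrite mulr0 add0r.
by apply: cvgD; [apply: cvgMr; exact: cvg_harmonic|exact: cvg_cst].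
Qed.

Section EntropyBound.
Context (R : realType) (mu : probability Omega R).
Context (Q : 'I_3 -> 'I_3 -> R) (r : 'I_3 -> R).
Hypothesis mu_inv : invariant_measure mu shift_map.
Hypothesis Q_pd : forall i, positive_distribution (Q i).
Hypothesis r_pd : positive_distribution r.

Let h := - (\sum_z law mu letter_pair z * ln (Q z.1 z.2)).

Lemma markov_entropy_ge0 : 0 <= h.
Proof.
rewrite oppr_ge0 -oppr_ge0 -sumrN sumr_ge0// => z _.
rewrite -mulrN mulr_ge0 ?law_ge0// oppr_ge0 ln_le0//.
have [Q0 <-] := Q_pd z.1; rewrite (bigD1 z.2)//= lerDl.
by apply: sumr_ge0 => j _; rewrite ltW.
Qed.

Lemma itinerary_entropy_linear (k : nat) (idx : Omega -> 'I_k) (eta : R) :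
  finite_valued idx -> 0 < eta ->
  exists c, forall n,
  - \sum_w law mu (itinerary idx n.+1) w * ln (law mu (itinerary idx n.+1) w) <=
  c + n.+1%:R * (h + eta).
Proof.
move=> m_idx eta0.
have k0 : (0 < k)%N by have := idx point; case: (k) => [[]//|].
have kR : 0 < k%:R :> R by rewrite ltr0n.
have k1 : 1 <= k%:R :> R by rewrite ler1n.
pose delta : R := eta / (2 * k%:R * (1 + eta)).
have den0 : 0 < 2 * k%:R * (1 + eta) by rewrite !mulr_gt0// addr_gt0.
have delta0 : 0 < delta by rewrite divr_gt0.
have delta1 : delta <= 1 by rewrite ler_pdivrMr// mul1r; nra.
have kd : k%:R * delta <= eta / 2.
  rewrite /delta mulrA ler_pdivrMr//; nra.
pose L := ln (k%:R / delta).
have L0 : 0 <= L by rewrite ln_ge0// ler_pdivlMr// mul1r (le_trans delta1).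
have e0 : 0 < eta / 2 / (1 + L) by rewrite !divr_gt0// ltr_pwDl.
have [m [C [E [mE muE EP]]]] := measurable_family_approximable mu m_idx e0.
exists (- (\sum_i law mu (fun x : Omega => x 0%N : 'I_3) i * ln (r i)) + m%:R * h) => n.
apply: (le_trans (itinerary_entropy_le mu_inv m_idx Q_pd r_pd C delta0 n)).
have := guess_cost mu m_idx delta0 delta1 mE EP.
set G := \sum_z _ * ln (guess _ _ _ _) => cost.
have : - G <= eta.
  apply: (le_trans cost); rewrite [leRHS](splitr eta) lerD//.
    apply: le_trans kd; apply: le_ln1Dx.
    by rewrite (@lt_le_trans _ _ 0)// mulr_ge0// ltW.
  rewrite (@le_trans _ _ (eta / 2 / (1 + L) * L))//; first by rewrite ler_wpM2r// ltW.
  by rewrite mulrAC ler_pdivrMr ?ltr_pwDl// ler_pM2l ?divr_gt0// lerDr.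
rewrite -/h => Geta.
have := markov_entropy_ge0; rewrite -/h natrD -!natr1 => h0.
have : n%:R * - G <= n%:R * eta by rewrite ler_wpM2l.
set S := \sum_i _; rewrite -(opprK (\sum_z _)) -/h.
lra.
Qed.

Lemma KS_entropy_le : (KS_entropy mu shift_map <= h%:E)%E.
Proof.
apply: ub_ereal_sup => _ [k [xi mxi ->]]; rewrite lee_fin.
have [idx m_idx idxP] := measurable_partition_index mxi.
(* If the limit does not exist, [lim] is the junk value [0]. *)
rewrite /entropy_wrt; set u := (X in lim (X @ _)).
have [cu|/dvgP ->] := pselect (cvg (u @ \oo)); last exact: markov_entropy_ge0.
apply/ler_addgt0Pr => eta eta0.
have [c cP] := itinerary_entropy_linear m_idx eta0.
have cuS : (u n.+1 @[n --> \oo]) --> lim (u @ \oo) by rewrite cvg_shiftS; exact: cu.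
apply: (ler_cvg_to cuS (@cvg_affine_div R c (h + eta))).
apply: nearW => n; rewrite /u ler_pM2l ?invr_gt0 ?ltr0n//.
by rewrite (partition_entropy_itinerary mu n.+1 idxP).
Qed.

End EntropyBound.

Definition first_letter (i : 'I_3) : set Omega := [set x | x 0%N = i].

Lemma measurable_partition_first_letter : measurable_partition first_letter.
Proof.
split; first exact: finite_valued_coordinate.
split.
- by apply/seteqP; split => // x _; exists (x 0%N).
- by move=> i j _ _ [x [<- <-]].
- by move=> i _; exists (fun=> i).
Qed.

Lemma markov_KS_entropy_ge (R : realType) (Q : 'I_3 -> 'I_3 -> R) r
    (nu : probability Omega R) :
  (forall i, positive_distribution (Q i)) -> positive_distribution r ->
  invariant_measure nu shift_map ->
  (forall n w, fine (nu [set x | forall j, (j < n)%N -> x j = w j]) =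
               path_weight Q r n w) ->
  ((- \sum_z law nu letter_pair z * ln (Q z.1 z.2))%:E <= KS_entropy nu shift_map)%E.
Proof.
move=> Q_pd r_pd inv nuE; set h := - _.
apply: ereal_sup_ubound; exists 3%N, first_letter.
  exact: measurable_partition_first_letter.
congr EFin; apply/esym; apply: cvg_lim => //; rewrite -cvg_shiftS.
pose c := - (\sum_i law nu (fun x : Omega => x 0%N : 'I_3) i * ln (r i)) - h.
rewrite (_ : (fun n => _) = (fun n => n.+1%:R^-1 * (c + n.+1%:R * h))).
  exact: (@cvg_affine_div R c h).
apply/funext => n; congr (_ * _).
pose idx (x : Omega) : 'I_3 := x 0%N.
rewrite (@partition_entropy_itinerary _ _ _ idx)//.
rewrite (_ : itinerary idx n.+1 = @word n.+1); last first.
  by apply/funext => x; apply/ffunP => j; rewrite !ffunE /idx iter_shift.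
under eq_bigr do rewrite {2}(law_markov_word nuE).
rewrite markov_cross_entropy// /c -natr1 /h; ring.
Qed.

Section VariationalPrinciple.
Context (R : realType) (eps : 'I_3 -> 'I_3 -> R) (beta lam : R).
Context (v u : 'I_3 -> R).
Hypothesis lam_gt0 : 0 < lam.
Hypothesis v_gt0 : forall i, 0 < v i.
Hypothesis u_gt0 : forall i, 0 < u i.
Let M i j := expR (- beta * eps i j).
Hypothesis right_eigen : forall i, \sum_j M i j * v j = lam * v i.
Hypothesis left_eigen : forall j, \sum_i u i * M i j = lam * u j.

Let Q i j := M i j * v j / (lam * v i).
Let r i := u i * v i / \sum_j u j * v j.

Let Q_pd i : positive_distribution (Q i).
Proof.
split=> [j|]; first by rewrite divr_gt0 ?mulr_gt0 ?expR_gt0.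
by rewrite -mulr_suml right_eigen divff// mulf_neq0// gt_eqF.
Qed.

Let uv_gt0 : 0 < \sum_j u j * v j.
Proof.
rewrite (bigD1 0)//= ltr_pwDl ?mulr_gt0//.
by apply: sumr_ge0 => j _; rewrite ltW// mulr_gt0.
Qed.

Let r_pd : positive_distribution r.
Proof.
split=> [j|]; first by rewrite divr_gt0 ?mulr_gt0.
by rewrite -mulr_suml divff// gt_eqF.
Qed.

Let r_stationary j : \sum_i r i * Q i j = r j.
Proof.
transitivity (\sum_i (u i * M i j) * (v j / (lam * \sum_j u j * v j))).
  apply: eq_bigr => i _; rewrite /r /Q; field.
  by rewrite !gt_eqF.
rewrite -mulr_suml left_eigen /r; field.
by rewrite !gt_eqF.
Qed.

Let markov_entropyE (mu : probability Omega R) : invariant_measure mu shift_map ->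
  - \sum_z law mu letter_pair z * ln (Q z.1 z.2) =
  ln lam + beta * \sum_z law mu letter_pair z * eps z.1 z.2.
Proof.
move=> inv; have mp := finite_valued_letter_pair.
have lnQ z : ln (Q z.1 z.2) = - beta * eps z.1 z.2 + ln (v z.2) - ln (v z.1) - ln lam.
  rewrite /Q ln_div ?posrE ?mulr_gt0 ?expR_gt0// !lnM ?posrE ?expR_gt0// expRK.
  ring.
have telescope : \sum_z law mu letter_pair z * ln (v z.2) =
    \sum_z law mu letter_pair z * ln (v z.1).
  rewrite -(expect_comp mu snd (fun i => ln (v i)) mp).
  rewrite -(expect_comp mu fst (fun i => ln (v i)) mp).
  apply: eq_bigr => i _; congr (_ * _).
  by rewrite -(law_iter_shift 1 inv (@finite_valued_coordinate 0)).
under eq_bigr do rewrite lnQ !mulrDr !mulrN.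
rewrite !big_split /= !sumrN telescope -mulr_suml (law_sum1 mu mp).
under eq_bigr do rewrite mulNr mulrN mulrCA.
rewrite sumrN -mulr_sumr; ring.
Qed.

Let integral_potential (mu : probability Omega R) :
  (\int[mu]_x (potential eps x)%:E =
   (- \sum_z law mu letter_pair z * eps z.1 z.2)%:E)%E.
Proof.
have := integral_finite_valued mu (fun z => - eps z.1 z.2) finite_valued_letter_pair.
under [X in _ = X%:E]eq_bigr do rewrite mulrN.
by rewrite sumrN.
Qed.

Lemma pressure_eq_ln_eigenvalue : pressure (potential eps) beta = ln lam.
Proof.
rewrite /pressure; set S := [set p | _].
suff -> : ereal_sup S = (ln lam)%:E by [].
apply/eqP; rewrite eq_le; apply/andP; split.
  apply: ub_ereal_sup => _ [mu inv ->].
  rewrite integral_potential -EFinM.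
  have := KS_entropy_le inv Q_pd r_pd; rewrite markov_entropyE// => KS.
  apply: (le_trans (leeD2r _ KS)); rewrite -EFinD lee_fin.
  by rewrite mulrN addrK.
have [nu nuE] := markov_measure_exists Q_pd r_pd.
have inv := markov_invariant nuE (proj2 r_pd) r_stationary.
have := markov_KS_entropy_ge Q_pd r_pd inv nuE; rewrite markov_entropyE// => KS.
apply: (@le_trans _ _
  (KS_entropy nu shift_map + beta%:E * \int[nu]_x (potential eps x)%:E)%E).
  rewrite integral_potential -EFinM.
  apply: le_trans (leeD2r _ KS); rewrite -EFinD lee_fin.
  by rewrite mulrN addrK.
by apply: ereal_sup_ubound; exists nu.
Qed.

End VariationalPrinciple.

(** * Asymptotics of the Perron eigenvalue *)

Lemma perron_root_exists (R : realType) (a b c d e f h : R) :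
  0 < a -> 0 < b -> 0 < c -> 0 < d -> 0 < e -> 0 < f -> h < 1 ->
  exists2 t : R, 0 < t & t ^+ 2 * (1 + t - h) =
    t * (d * f + b * e) + a * c * (1 + t - h) + (a * d * e + b * c * f).
Proof.
move=> a0 b0 c0 d0 e0 f0 h1.
have := mulr_gt0 a0 c0; have := mulr_gt0 d0 f0; have := mulr_gt0 b0 e0.
have := mulr_gt0 (mulr_gt0 a0 d0) e0; have := mulr_gt0 (mulr_gt0 b0 c0) f0.
set C1 := b * c * f; set C2 := a * d * e.
set B1 := b * e; set B2 := d * f; set D := a * c.
move=> C10 C20 B10 B20 D0.
pose T := 1 + (B2 + B1) + D + (C2 + C1).
pose p : {poly R} := 'X ^+ 2 * ('X + (1 - h)%:P) - 'X * (B2 + B1)%:P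
  - D%:P * ('X + (1 - h)%:P) - (C2 + C1)%:P.
have pE x : p.[x] = x ^+ 2 * (1 + x - h) - (x * (B2 + B1) + D * (1 + x - h) + (C2 + C1)).
  by rewrite /p !(hornerD, hornerN, hornerM, hornerXn, hornerX, hornerC); ring.
have T1 : 1 <= T by rewrite /T; lra.
have p0 : p.[0] < 0.
  rewrite pE; have : 0 < D * (1 + 0 - h) by rewrite mulr_gt0//; lra.
  lra.
have pT : 0 <= p.[T].
  rewrite pE; set k := 1 + T - h; have k1 : 1 <= k by rewrite /k; lra.
  have Tk : 1 <= T * k by rewrite (le_trans T1)// ler_peMr//; lra.
  have h1' : T * (B2 + B1) <= T * k * (B2 + B1) by rewrite ler_wpM2r ?ler_peMr//; lra.
  have h2 : D * k <= T * k * D by rewrite mulrC ler_wpM2r ?ler_peMl//; lra.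
  have h3 : C2 + C1 <= T * k * (C2 + C1) by rewrite ler_peMl//; lra.
  have : T ^+ 2 * k = T * k + T * k * (B2 + B1) + T * k * D + T * k * (C2 + C1).
    have TE : T = 1 + (B2 + B1) + D + (C2 + C1) by [].
    have -> : T ^+ 2 * k = T * k * T by ring.
    by rewrite {2}TE; ring.
  lra.
have [t /andP[t0 _] /rootP pt] : exists2 t, 0 <= t <= T & root p t.
  by apply: poly_ivt; [exact: le_trans ler01 T1|rewrite (ltW p0)].
exists t; last by apply/eqP; rewrite -subr_eq0 -pE pt.
by rewrite lt_neqAle t0 andbT; apply/eqP => t00; move: p0; rewrite {1}t00 pt ltxx.
Qed.

Section Perron.
Context (R : realType) (eps : 'I_3 -> 'I_3 -> R).
Hypothesis eps11 : eps 0 0 = 0.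
Hypothesis eps22 : eps 1 1 = 0.
Hypothesis eps_gt0 : forall i j : 'I_3,
  (i, j) <> (0, 0) -> (i, j) <> (1, 1) -> 0 < eps i j.

Let P : R -> R := pressure (potential eps).
Let E (beta r : R) : R := expR (- beta * r).

(* [1 + t], with [t = expR (P beta) - 1], is the spectral radius: the equation is
   [det ((1 + t) I - M) = 0] for the matrix [M i j = E beta (eps i j)]. *)
Lemma characteristic_equation beta : 0 < beta ->
  let t := expR (P beta) - 1 in
  let kappa := 1 + t - E beta (eps 2 2) in
  0 < t /\ t ^+ 2 * kappa =
    t * (E beta (eps 1 2 + eps 2 1) + E beta (eps 0 2 + eps 2 0)) +
    E beta (eps 0 1 + eps 1 0) * kappa +
    (E beta (eps 0 1 + eps 1 2 + eps 2 0) + E beta (eps 0 2 + eps 1 0 + eps 2 1)).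
Proof.
move=> beta0 /=.
have ED x y : E beta (x + y) = E beta x * E beta y by rewrite /E mulrDr expRD.
have E0 x : 0 < E beta x by exact: expR_gt0.
have h1 : E beta (eps 2 2) < 1.
  by rewrite /E expR_lt1 mulNr oppr_lt0 mulr_gt0// eps_gt0.
have E00 : E beta (eps 0 0) = 1 by rewrite eps11 /E mulr0 expR0.
have E11 : E beta (eps 1 1) = 1 by rewrite eps22 /E mulr0 expR0.
have [t t0 tE] := perron_root_exists (E0 (eps 0 1)) (E0 (eps 0 2)) (E0 (eps 1 0))
  (E0 (eps 1 2)) (E0 (eps 2 0)) (E0 (eps 2 1)) h1.
set a := E beta (eps 0 1) in tE *; set b := E beta (eps 0 2) in tE *.
set c := E beta (eps 1 0) in tE *; set d := E beta (eps 1 2) in tE *.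
set e := E beta (eps 2 0) in tE *; set f := E beta (eps 2 1) in tE *.
set h := E beta (eps 2 2) in h1 tE *.
have [a0 b0 c0] : [/\ 0 < a, 0 < b & 0 < c] by split; exact: E0.
have [d0 e0 f0] : [/\ 0 < d, 0 < e & 0 < f] by split; exact: E0.
have tac : 0 < t ^+ 2 - a * c.
  rewrite -(pmulr_rgt0 _ (_ : 0 < 1 + t - h)); last by lra.
  rewrite mulrBr [X in X - _]mulrC tE.
  have : 0 < t * (d * f + b * e) by rewrite mulr_gt0// addr_gt0// mulr_gt0.
  have : 0 < a * d * e + b * c * f by rewrite addr_gt0// !mulr_gt0.
  by move=> ? ?; lra.
pose vec x y z (i : 'I_3) : R := if i == 0 then x else if i == 1 then y else z.
have vec_gt0 x y z : 0 < x -> 0 < y -> 0 < z -> forall i, 0 < vec x y z i.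
  by move=> x0 y0 z0 i; rewrite /vec; case: ifP => // _; case: ifP.
have PE : P beta = ln (1 + t).
  apply: (@pressure_eq_ln_eigenvalue R eps beta (1 + t)
    (vec (b * t + a * d) (t * d + b * c) (t ^+ 2 - a * c))
    (vec (e * t + c * f) (t * f + e * a) (t ^+ 2 - a * c))).
  - by rewrite addr_gt0.
  - by apply: vec_gt0 => //; rewrite addr_gt0// mulr_gt0.
  - by apply: vec_gt0 => //; rewrite addr_gt0// mulr_gt0.
  - move=> i; case: (ord3P i) => ->; rewrite sum_ord3 /vec /= -!/(E beta _)
      ?E00 ?E11 -/a -/b -/c -/d -/e -/f -/h.
    + by ring.
    + by ring.
    + lra.
  - move=> i; case: (ord3P i) => ->; rewrite sum_ord3 /vec /= -!/(E beta _)
      ?E00 ?E11 -/a -/b -/c -/d -/e -/f -/h.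
    + by ring.
    + by ring.
    + lra.
have -> : expR (P beta) - 1 = t.
  by rewrite PE lnK ?posrE ?addr_gt0// addrC addKr.
by rewrite !ED.
Qed.

End Perron.

Lemma quadratic_root (R : realType) (x k p q : R) :
  0 < x -> 0 < k -> 0 <= q -> x ^+ 2 * k = x * p + q ->
  x = (p + Num.sqrt (p ^+ 2 + 4 * k * q)) / (2 * k).
Proof.
move=> x0 k0 q0 e.
have -> : p ^+ 2 + 4 * k * q = (2 * k * x - p) ^+ 2.
  have -> : q = x ^+ 2 * k - x * p by rewrite e; ring.
  by ring.
rewrite sqrtr_sqr ger0_norm; first by field; rewrite gt_eqF.
have : p <= x * k.
  by rewrite -(ler_pM2l x0) mulrA -expr2 e lerDl.
have : 0 < x * k by rewrite mulr_gt0.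
by rewrite -mulrA (mulrC k); lra.
Qed.

Lemma quadratic_upper_bound (R : realType) (x p q : R) :
  0 < x -> 0 <= p -> 0 <= q -> x ^+ 2 <= x * p + q -> x <= p + Num.sqrt q.
Proof.
move=> x0 p0 q0 e; rewrite leNgt; apply/negP => lt.
have s0 := sqrtr_ge0 q.
have : q <= x * Num.sqrt q.
  by rewrite -{1}(sqr_sqrtr q0) expr2 ler_wpM2r//; lra.
have : x * (p + Num.sqrt q) < x * x by rewrite ltr_pM2l.
rewrite -expr2 mulrDr; lra.
Qed.

Lemma ln1D_ge (R : realType) (t : R) : 0 < t -> t / (1 + t) <= ln (1 + t).
Proof.
move=> t0; have t1 : 0 < 1 + t by lra.
have : ln (1 + - (t / (1 + t))) <= - (t / (1 + t)).
  by apply: le_ln1Dx; rewrite ltrN2 ltr_pdivrMr// mul1r; lra.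
rewrite (_ : 1 + - (t / (1 + t)) = (1 + t)^-1); last by field; rewrite gt_eqF.
by rewrite lnV ?posrE// lerN2.
Qed.

Lemma cvg_exp_rate (R : realType) (r c : R) : c <= r ->
  (expR (- beta * r) * expR (c * beta)) @[beta --> +oo] --> ((r == c)%:R : R).
Proof.
move=> cr; under eq_fun do rewrite -expRD.
have [->|rc] := eqVneq r c.
  under eq_fun do rewrite mulNr mulrC addNr expR0.
  exact: cvg_cst.
have rc0 : 0 < r - c by rewrite subr_gt0 lt_neqAle eq_sym rc.
rewrite (_ : (fun _ => _) = (fun y => expR (- y)) \o (fun beta => (r - c) * beta)); last first.
  by apply/funext => beta /=; congr expR; ring.
apply: cvg_comp (@cvgr_expR R).
by apply: gt0_cvgMry => //; exact: cvg_id.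
Qed.

Lemma cvg_inv_pinfty (R : realType) : (beta^-1) @[beta --> +oo] --> (0 : R).
Proof.
apply/gtr0_cvgV0; last exact: cvg_id.
by apply: nbhs_pinfty_gt; rewrite num_real.
Qed.

Lemma cvg_sqrt (R : realType) (F : set_system R) (FF : Filter F) (f : R -> R) (a : R) :
  f x @[x --> F] --> a -> Num.sqrt (f x) @[x --> F] --> Num.sqrt a.
Proof. by move=> fa; exact: (cvg_comp _ _ fa (@sqrt_continuous R a)). Qed.

Section Asymptotics.
Context (R : realType) (P : R -> R) (h r1 r2 r3 r4 r5 : R).
Hypothesis h_gt0 : 0 < h.
Hypothesis r1_gt0 : 0 < r1.
Hypothesis r2_gt0 : 0 < r2.
Hypothesis r3_gt0 : 0 < r3.
Hypothesis r4_gt0 : 0 < r4.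
Hypothesis r5_gt0 : 0 < r5.
Let E (beta r : R) : R := expR (- beta * r).
Let t beta := expR (P beta) - 1.
Let kappa beta := 1 + t beta - E beta h.
Let B beta := E beta r1 + E beta r2.
Let C beta := E beta r4 + E beta r5.
Hypothesis equation : forall beta, 0 < beta ->
  0 < t beta /\ t beta ^+ 2 * kappa beta =
    t beta * B beta + E beta r3 * kappa beta + C beta.

Let E_gt0 beta r : 0 < E beta r. Proof. exact: expR_gt0. Qed.

Let cvgE r : 0 < r -> E beta r @[beta --> +oo] --> (0 : R).
Proof.
move=> r0; have := cvg_exp_rate (ltW r0); rewrite gt_eqF//.
by under eq_fun do rewrite mul0r expR0 mulr1.
Qed.

Let near_gt0 : \forall beta \near +oo, 0 < (beta : R).
Proof. by apply: nbhs_pinfty_gt; rewrite num_real. Qed.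

Let cvg_t : t beta @[beta --> +oo] --> (0 : R).
Proof.
pose D beta := E beta r3 + 2 * C beta.
have cB : (2 * B beta + Num.sqrt (D beta)) @[beta --> +oo] --> (0 : R).
  rewrite -[X in _ --> X](_ : 2 * (0 + 0) + Num.sqrt (0 + 2 * (0 + 0)) = 0 :> R); last first.
    by rewrite !(addr0, mulr0, sqrtr0).
  apply: cvgD.
    by apply: cvgMr; apply: cvgD; exact: cvgE.
  apply: cvg_sqrt.
  by apply: cvgD; [exact: cvgE|apply: cvgMr; apply: cvgD; exact: cvgE].
apply: (@squeeze_cvgr _ _ _ _ (fun=> 0) (fun beta => 2 * B beta + Num.sqrt (D beta))) => //.
  have h2 : (0 : R) < 2^-1 by rewrite invr_gt0.
  have nearE : \forall beta \near +oo, E beta h < 2^-1.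
    by apply: (@cvgr_lt _ _ _ _ (fun beta => E beta h) 0) => //; exact: cvgE.
  near=> beta.
  have beta0 : 0 < beta by near: beta; exact: near_gt0.
  have Eh : E beta h < 2^-1 by near: beta; exact: nearE.
  have [t0 e] := equation beta0; rewrite (ltW t0) /=.
  have k2 : 2^-1 < kappa beta by rewrite /kappa; lra.
  have B0 : 0 < B beta by rewrite addr_gt0.
  have C0 : 0 < C beta by rewrite addr_gt0.
  apply: quadratic_upper_bound => //.
  - by rewrite mulr_ge0// ltW.
  - by rewrite /D addr_ge0 ?mulr_ge0// ltW.
  have k0 : 0 < kappa beta by lra.
  rewrite -(ler_pM2r k0) e /D.
  have : t beta * B beta <= t beta * B beta * (2 * kappa beta).
    by rewrite ler_peMr ?mulr_ge0 ?(ltW t0) ?(ltW B0)//; lra.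
  have : C beta <= C beta * (2 * kappa beta) by rewrite ler_peMr ?(ltW C0)//; lra.
  by move=> ? ?; lra.
exact: cvg_cst.
Unshelve. all: by end_near.
Qed.

Let cvg_kappa : kappa beta @[beta --> +oo] --> (1 : R).
Proof.
rewrite -[X in _ --> X](_ : 1 + 0 - 0 = 1 :> R); last by rewrite subr0 addr0.
by apply: cvgB; [apply: cvgD; [exact: cvg_cst|exact: cvg_t]|exact: cvgE].
Qed.

Let rho : R := Num.min (Num.min r1 r2) (Num.min r3 (Num.min r4 r5) / 2).

Let min_or (x y : R) : [\/ Num.min x y = x | Num.min x y = y].
Proof. by rewrite minEle; case: ifP; [left|right]. Qed.

Let rho_le : [/\ rho <= r1, rho <= r2, 2 * rho <= r3, 2 * rho <= r4 & 2 * rho <= r5].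
Proof.
have h1 : rho <= Num.min r1 r2 by rewrite ge_min lexx.
have h2 : 2 * rho <= Num.min r3 (Num.min r4 r5).
  by rewrite mulrC -ler_pdivlMr// ge_min lexx orbT.
move: h1 h2; rewrite !le_min => /andP[-> ->] /andP[-> /andP[-> ->]].
by split.
Qed.

Let lB : R := (r1 == rho)%:R + (r2 == rho)%:R.
Let lC : R := (r4 == 2 * rho)%:R + (r5 == 2 * rho)%:R.
Let lD : R := (r3 == 2 * rho)%:R * 1 + lC.

Let lBD_gt0 : 0 < lB \/ 0 < lD.
Proof.
have [n1 n2] : (0 <= (r1 == rho)%:R :> R) /\ (0 <= (r2 == rho)%:R :> R) by [].
have [n3 [n4 n5]] : (0 <= (r3 == 2 * rho)%:R :> R) /\
  (0 <= (r4 == 2 * rho)%:R :> R) /\ (0 <= (r5 == 2 * rho)%:R :> R) by [].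
rewrite /lD /lC /lB mulr1.
have e2 x : x / 2 = rho -> x = 2 * rho by move=> <-; field.
case: (min_or (Num.min r1 r2) (Num.min r3 (Num.min r4 r5) / 2)); rewrite -/rho.
  by case: (min_or r1 r2) => -> e; left; move: n1 n2; rewrite e eqxx /=; lra.
case: (min_or r3 (Num.min r4 r5)) => ->.
  by move=> /esym/e2 e; right; move: n4 n5; rewrite e eqxx /=; lra.
by case: (min_or r4 r5) => -> /esym/e2 e; right; move: n3 n4 n5; rewrite e eqxx /=; lra.
Qed.

Let s beta := t beta * expR (rho * beta).
Let B' beta := B beta * expR (rho * beta).
Let D' beta := E beta r3 * expR (2 * rho * beta) * kappa beta +
               C beta * expR (2 * rho * beta).

Let cvg_B' : B' beta @[beta --> +oo] --> lB.
Proof.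
have [h1 h2 _ _ _] := rho_le.
by under eq_fun do rewrite /B' mulrDl; apply: cvgD; exact: cvg_exp_rate.
Qed.

Let cvg_D' : D' beta @[beta --> +oo] --> lD.
Proof.
have [_ _ h3 h4 h5] := rho_le.
apply: cvgD; first by apply: cvgM; [exact: cvg_exp_rate|exact: cvg_kappa].
by under eq_fun do rewrite mulrDl; apply: cvgD; exact: cvg_exp_rate.
Qed.

Let limit : R := (lB + Num.sqrt (lB ^+ 2 + 4 * 1 * lD)) / (2 * 1).

Let limit_gt0 : 0 < limit.
Proof.
have lB0 : 0 <= lB by rewrite addr_ge0.
have lD0 : 0 <= lD by rewrite addr_ge0 ?addr_ge0// mulr_ge0.
rewrite divr_gt0 ?mulr_gt0//; case: lBD_gt0 => h0.
  by rewrite ltr_pwDl// sqrtr_ge0.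
by rewrite ltr_wpDl// sqrtr_gt0 ltr_wpDl ?sqr_ge0// !mulr_gt0.
Qed.

Let cvg_s : s beta @[beta --> +oo] --> limit.
Proof.
pose F beta := (B' beta + Num.sqrt (B' beta ^+ 2 + 4 * kappa beta * D' beta)) /
  (2 * kappa beta).
have : F beta @[beta --> +oo] --> limit.
  apply: cvgM.
    apply: cvgD; first exact: cvg_B'.
    apply: cvg_sqrt; apply: cvgD; first by rewrite !expr2; apply: cvgM; exact: cvg_B'.
    apply: cvgM; last exact: cvg_D'.
    by apply: cvgMr; exact: cvg_kappa.
  by apply: cvgV; [rewrite mulr1|apply: cvgMr; exact: cvg_kappa].
apply: cvg_trans; apply: near_eq_cvg; near=> beta.
have beta0 : 0 < beta by near: beta; exact: near_gt0.
have [t0 e] := equation beta0.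
have k0 : 0 < kappa beta.
  have Eh : E beta h < 1 by rewrite /E expR_lt1 mulNr oppr_lt0 mulr_gt0.
  by rewrite /kappa; lra.
apply/esym/quadratic_root => //; first by rewrite mulr_gt0// expR_gt0.
  by rewrite ltW// addr_gt0// !mulr_gt0// ?expR_gt0// addr_gt0.
rewrite /s /B' /D'.
have -> : expR (2 * rho * beta) = expR (rho * beta) * expR (rho * beta).
  by rewrite -expRD; congr expR; ring.
transitivity (t beta ^+ 2 * kappa beta * (expR (rho * beta) * expR (rho * beta))).
  by ring.
by rewrite e; ring.
Unshelve. all: by end_near.
Qed.

Let cvg_scaled : (P beta * expR (rho * beta)) @[beta --> +oo] --> limit.
Proof.
have PE beta : P beta = ln (1 + t beta).
  by rewrite /t addrC subrK expRK.
apply: (@squeeze_cvgr _ _ _ _ (fun beta => s beta / (1 + t beta)) s) => //.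
- near=> beta.
  have beta0 : 0 < beta by near: beta; exact: near_gt0.
  have [t0 _] := equation beta0.
  rewrite PE /s mulrAC !ler_pM2r ?expR_gt0// ln1D_ge//= le_ln1Dx//; lra.
- rewrite -[X in _ --> X](_ : limit / (1 + 0) = limit); last by rewrite addr0 divr1.
  apply: cvgM; first exact: cvg_s.
  apply: cvgV; first by rewrite addr0.
  by apply: cvgD; [exact: cvg_cst|exact: cvg_t].
Unshelve. all: by end_near.
Qed.

Lemma scaled_pressure_cvg :
  exists rho l : R, (beta^-1 * ln (P beta)) @[beta --> +oo] --> - rho /\
    (P beta * expR (rho * beta)) @[beta --> +oo] --> l.
Proof.
exists rho, limit; split; last exact: cvg_scaled.
have lnG : ln (P beta * expR (rho * beta)) @[beta --> +oo] --> ln limit.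
  exact: (cvg_comp _ _ cvg_scaled (continuous_ln limit_gt0)).
have : (beta^-1 * ln (P beta * expR (rho * beta)) - rho) @[beta --> +oo] -->
    0 * ln limit - rho.
  apply: cvgB; last exact: cvg_cst.
  by apply: cvgM => //; exact: cvg_inv_pinfty.
rewrite mul0r sub0r; apply: cvg_trans; apply: near_eq_cvg; near=> beta.
have beta0 : 0 < beta by near: beta; exact: near_gt0.
have [t0 _] := equation beta0.
have P0 : 0 < P beta by rewrite -expR_gt1 -subr_gt0.
rewrite lnM ?posrE ?expR_gt0// expRK; field.
by rewrite gt_eqF.
Unshelve. all: by end_near.
Qed.

End Asymptotics.

Theorem proposition7p2 (R : realType) (eps : 'I_3 -> 'I_3 -> R)
  (eps11 : eps 0 0 = 0) (eps22 : eps 1 1 = 0)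
  (eps_gt0 : forall i j : 'I_3,
     (i, j) <> (0, 0) -> (i, j) <> (1, 1) -> 0 < eps i j) :
  let P : R -> R := pressure (potential eps) in
  let rho : R := - lim ((beta^-1 * ln (P beta)) @[beta --> +oo]) in
  let g : R -> R := fun beta => P beta * expR (rho * beta) in
  exists l : R, g beta @[beta --> +oo] --> l.
Proof.
move=> P rho g.
have eq := characteristic_equation eps11 eps22 eps_gt0.
have [||||||rho' [l [lim_rho lim_g]]] := scaled_pressure_cvg _ _ _ _ _ _ eq.
all: try by rewrite ?addr_gt0// eps_gt0.
exists l; rewrite /g /rho (cvg_lim _ lim_rho)// opprK.
exact: lim_g.
Qed.
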